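(* Suppose $n>2$ and let $\sigma=(1\,2\,\dots\,n)\in S_n$. The stabilizer in $G$ of $M=I+P_\sigma$ is isomorphic to the dihedral group $D_{4n}$ with $4n$ elements, and the $G$-orbit of $M$ has $(n-1)!\,n!/2$ elements.
   Context: $P_\sigma$ is the permutation matrix of $\sigma\in S_n$ with $P_\sigma P_\tau=P_{\sigma\tau}$, and $I$ is the $n\times n$ identity matrix. $G$ is the group of order $2(n!)^2$ acting on $n\times n$ matrices by the maps $M\mapsto P_\alpha M P_\beta^{-1}$ and $M\mapsto P_\alpha M^T P_\beta^{-1}$ for $\alpha,\beta\in S_n$ (generated by row permutations, column permutations and transpose). *)

(* Defs.v *)
From HB Require Import structures.
From mathcomp Require Import all_boot all_order all_fingroup all_algebra all_solvable.
From mathcomp Require Import finmap.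

Set Implicit Arguments.
Unset Strict Implicit.
Unset Printing Implicit Defensive.

Import GRing.Theory.
Local Open Scope group_scope.

(* The group G of order 2 (n!)^2.  [GElt a b t] stands for the map
   M |-> P_a M P_b^-1 if t = false, and M |-> P_a M^T P_b^-1 if t = true. *)
Record mxsym (n : nat) := GElt {
  mxsym_row : 'S_n;
  mxsym_col : 'S_n;
  mxsym_tr : bool }.

Section Group.
Variable n : nat.
Implicit Types g h k : mxsym n.

Definition mxsym_prod g := (mxsym_row g, mxsym_col g, mxsym_tr g).
Definition prod_mxsym (x : 'S_n * 'S_n * bool) := GElt x.1.1 x.1.2 x.2.

Lemma mxsym_prodK : cancel mxsym_prod prod_mxsym.
Proof. by case. Qed.

Lemma prod_mxsymK : cancel prod_mxsym mxsym_prod.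
Proof. by case=> [[]]. Qed.

HB.instance Definition _ := Finite.copy (mxsym n) (can_type mxsym_prodK).

(* Composition of maps, [mxsym_mul g h] being g after h: since
   (P_a M P_b^-1)^T = P_b M^T P_a^-1, a transpose in g swaps the row and
   column permutations of h. *)
Definition mxsym_mul g h : mxsym n :=
  if mxsym_tr g
  then GElt (mxsym_row g * mxsym_col h) (mxsym_col g * mxsym_row h)
            (~~ mxsym_tr h)
  else GElt (mxsym_row g * mxsym_row h) (mxsym_col g * mxsym_col h)
            (mxsym_tr h).

Definition mxsym_one : mxsym n := GElt 1 1 false.

Definition mxsym_inv g : mxsym n :=
  if mxsym_tr g
  then GElt (mxsym_col g)^-1 (mxsym_row g)^-1 true
  else GElt (mxsym_row g)^-1 (mxsym_col g)^-1 false.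

Lemma mxsym_mulA : associative mxsym_mul.
Proof.
by move=> [a1 b1 []] [a2 b2 []] [a3 b3 []]; rewrite /mxsym_mul /= !mulgA.
Qed.

Lemma mxsym_mul1 : left_id mxsym_one mxsym_mul.
Proof. by move=> [a b t]; rewrite /mxsym_mul /= !mul1g. Qed.

Lemma mxsym_mulV : left_inverse mxsym_one mxsym_inv mxsym_mul.
Proof. by move=> [a b []]; rewrite /mxsym_mul /mxsym_inv /= !mulVg. Qed.

HB.instance Definition _ :=
  Finite_isGroup.Build (mxsym n) mxsym_mulA mxsym_mul1 mxsym_mulV.

Lemma mxsym_mulE g h : g * h = mxsym_mul g h.
Proof. by []. Qed.

Lemma card_mxsym : #|{: mxsym n}| = (2 * n`! ^ 2)%N.
Proof.
rewrite (bij_eq_card (Bijective mxsym_prodK prod_mxsymK)).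
by rewrite !card_prod card_bool !card_Sn -mulnn mulnC.
Qed.

End Group.

Section Action.
Variables (R : nzSemiRingType) (n : nat).
Implicit Types (M : 'M[R]_n) (g h : mxsym n).

(* [perm_mx] is multiplicative ([perm_mxM]), so [perm_mx b^-1] is the inverse
   of [perm_mx b]. *)
Definition mxsym_act g M : 'M[R]_n :=
  (perm_mx (mxsym_row g) *m (if mxsym_tr g then M^T else M)
     *m perm_mx (mxsym_col g)^-1)%R.

Lemma mxsym_actE g M i j :
  mxsym_act g M i j =
    (if mxsym_tr g then M (mxsym_col g j) (mxsym_row g i)
     else M (mxsym_row g i) (mxsym_col g j)).
Proof.
rewrite /mxsym_act -row_permE -col_permE !mxE.
by case: (mxsym_tr g); rewrite ?mxE.
Qed.

Lemma mxsym_act1 M : mxsym_act 1 M = M.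
Proof. by apply/matrixP=> i j; rewrite mxsym_actE /= !perm1. Qed.

Lemma mxsym_actM g h M : mxsym_act (g * h) M = mxsym_act g (mxsym_act h M).
Proof.
apply/matrixP=> i j; rewrite !mxsym_actE.
case: g h => [a1 b1 []] [a2 b2 []];
  by rewrite mxsym_mulE /mxsym_mul /= !permM.
Qed.

(* For n > 1 distinct elements of [mxsym n] act by distinct maps, so that
   [mxsym n] is the group of these maps. *)
Lemma mxsym_act_inj g h : 1 < n -> mxsym_act g =1 mxsym_act h -> g = h.
Proof.
move=> n_gt1 eq_gh.
pose pos (k : mxsym n) i j := if mxsym_tr k
  then (mxsym_col k j, mxsym_row k i) else (mxsym_row k i, mxsym_col k j).
have actE k M i j : mxsym_act k M i j = M (pos k i j).1 (pos k i j).2.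
  by rewrite mxsym_actE /pos; case: (mxsym_tr k).
have eq_pos i j : pos g i j = pos h i j.
  have := congr1 (fun A : 'M[R]_n => A i j)
    (eq_gh (delta_mx (pos g i j).1 (pos g i j).2)).
  rewrite !actE !mxE !eqxx /=.
  case: eqP => [e1|_]; case: eqP => [e2|_] /eqP; rewrite /= ?oner_eq0 // => _.
  by rewrite [LHS]surjective_pairing [RHS]surjective_pairing e1 e2.
pose o0 := Ordinal (ltnW n_gt1); pose o1 := Ordinal n_gt1.
have no_tr (a b : 'S_n) : ~ (forall i j, a i = b j).
  move=> eq_ab; have /perm_inj/(congr1 val) // : a o0 = a o1.
  by rewrite !(eq_ab _ o0).
case: g h eq_pos {eq_gh actE} => [a1 b1 t1] [a2 b2 t2] eq_pos.
case: t1 t2 eq_pos => [] [] eq_pos.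
- by congr GElt; apply/permP=> i; have [] := eq_pos i i.
- by case: (no_tr a1 b2) => i j; have [] := eq_pos i j.
- by case: (no_tr a1 b2) => i j; have [] := eq_pos i j.
- by congr GElt; apply/permP=> i; have [] := eq_pos i i.
Qed.

(* [astab] and [orbit] of the library need the set acted upon to be finite,
   which 'M[R]_n is not. *)
Definition mxsym_stab M : {set mxsym n} := [set g | mxsym_act g M == M].

Lemma mxsym_stab_group_set M : group_set (mxsym_stab M).
Proof.
apply/group_setP; split=> [|g h]; first by rewrite inE mxsym_act1.
by rewrite !inE mxsym_actM => /eqP gM /eqP ->; rewrite gM.
Qed.

Canonical mxsym_stab_group M := Group (mxsym_stab_group_set M).

Definition mxsym_orbit M : {fset 'M[R]_n} :=
  [fset mxsym_act g M | g in {: mxsym n}]%fset.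

End Action.

(* The n-cycle 0 -> 1 -> ... -> n-1 -> 0; points are numbered from 0. *)
Definition cycle_perm (n : nat) : 'S_n := perm (@ordS_inj n).

(* Main.v *)
(** The support of [I + P_sigma] is the biadjacency matrix of a 2n-cycle whose
    vertices are alternately columns and rows, and elements of the stabilizer
    are exactly the automorphisms of this cycle, transposition exchanging the
    two kinds of vertices. An automorphism fixing an arc is trivial, so there
    are at most [4n] of them; the rotation by one step has order [2n] and, with
    a reflection outside the group it generates, accounts for all of them.
    The group is dihedral because the reflection and its product with the
    rotation are two generating involutions. *)
Require Import Defs.
From mathcomp Require Import all_boot all_order all_fingroup all_algebra all_solvable.
From mathcomp Require Import finmap.

Set Implicit Arguments.
Unset Strict Implicit.
Unset Printing Implicit Defensive.

Import GRing.Theory.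
Local Open Scope group_scope.

(** Two elements agree on [M] exactly when they lie in the same left coset of the stabilizer, so
    evaluating at one representative per coset is a bijection onto the orbit. *)
Lemma card_mxsym_orbit (R : nzSemiRingType) n (M : 'M[R]_n) :
  #|` mxsym_orbit M|%fset = #|[set: mxsym n] : mxsym_stab M|.
Proof.
have fiberP g h : (mxsym_act g M == mxsym_act h M) = (g \in h *: mxsym_stab M).
  rewrite mem_lcoset inE mxsym_actM; apply/eqP/eqP => [->|hgM].
    by rewrite -mxsym_actM mulVg mxsym_act1.
  by rewrite -[in RHS]hgM -mxsym_actM mulgV mxsym_act1.
have reprM g : mxsym_act (repr (g *: mxsym_stab M)) M = mxsym_act g M.
  by apply/eqP; rewrite fiberP; apply: (mem_repr g); apply: lcoset_refl.
rewrite -card_lcosets.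
have -> : mxsym_orbit M =
    [fset mxsym_act (repr C) M
      | C in lcosets (mxsym_stab M) [set: mxsym n]]%fset.
  apply/fsetP=> N; apply/imfsetP/imfsetP => /= [[g _ ->]|[C]].
    exists (g *: mxsym_stab M); last by rewrite reprM.
    by apply/lcosetsP; exists g; rewrite ?inE.
  by case/lcosetsP=> g _ -> ->; exists g; rewrite ?reprM.
rewrite card_in_imfset /=; first by rewrite -cardE.
move=> _ _ /lcosetsP[g _ ->] /lcosetsP[h _ ->]; rewrite !reprM => /eqP.
by rewrite fiberP => /lcoset_eqP ->.
Qed.

Section CyclePerm.
Variable n : nat.
Implicit Types i j : 'I_n.

Lemma cycle_permX k i : ((cycle_perm n ^+ k) i : nat) = (i + k) %% n.
Proof.
elim: k => [|k IHk]; first by rewrite expg0 perm1 addn0 modn_small.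
by rewrite expgSr permM permE /= IHk -addn1 modnDml addn1 addnS.
Qed.

Lemma cycle_permX_eq1 k : 0 < n -> (cycle_perm n ^+ k == 1) = (n %| k).
Proof.
move=> n_gt0; apply/eqP/idP => [sk1 | /dvdnP[q ->]].
  have := cycle_permX k (Ordinal n_gt0).
  by rewrite sk1 perm1 add0n /= /dvdn => <-.
by apply/permP=> i; apply: val_inj; rewrite /= cycle_permX addnC modnMDl perm1 modn_small.
Qed.

Lemma cycle_perm_neq i : 1 < n -> cycle_perm n i != i.
Proof.
move=> n_gt1; apply/eqP=> /(congr1 val) /=.
rewrite -{1}[cycle_perm n]expg1 cycle_permX addn1; have := ltn_ord i.
rewrite leq_eqVlt => /predU1P[iE | iS_lt].
  by rewrite iE modnn => i0; rewrite -iE -i0 in n_gt1.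
by rewrite modn_small // => /eqP; rewrite eqn_leq ltnn.
Qed.

Definition rev_perm : 'S_n := perm (@rev_ord_inj n).

Lemma rev_permK : involutive rev_perm.
Proof. by move=> i; rewrite !permE rev_ordK. Qed.

(** The dihedral relation: conjugation by the reversal inverts the n-cycle. The last index, where
    the successor wraps around to 0, is treated separately. *)
Lemma rev_cycle_perm i :
  cycle_perm n (rev_perm (cycle_perm n i)) = rev_perm i.
Proof.
apply: val_inj; rewrite !permE /= ; have := ltn_ord i.
rewrite leq_eqVlt => /predU1P[iE|iS_lt].
  rewrite [in RHS]iE subnn [X in n - X.+1](_ : _ = 0) ?iE ?modnn //.
  by rewrite subn1 prednK ?modnn // -iE.
rewrite (modn_small iS_lt) subnSK //.
by rewrite ?modn_small ?ltn_subrL ?(leq_ltn_trans _ iS_lt).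
Qed.

(** Adjacency of row [i] and column [j] in the 2n-cycle. *)
Definition cycle_inc : rel 'I_n :=
  [rel i j | (j == i) || (j == cycle_perm n i)].

Lemma cycle_inc_id i : cycle_inc i i.
Proof. by rewrite /cycle_inc /= eqxx. Qed.

Lemma cycle_inc_cycle i : cycle_inc i (cycle_perm n i).
Proof. by rewrite /cycle_inc /= eqxx orbT. Qed.

(** As the n-cycle has no fixed point, the supports of the two summands are disjoint, so [1 + 1]
    never occurs, whatever its value in [R]. *)
Lemma cycle_mxE (R : nzSemiRingType) i j : 1 < n ->
  (1%:M + perm_mx (cycle_perm n) : 'M[R]_n)%R i j = ((cycle_inc i j)%:R)%R.
Proof.
move=> n_gt1; rewrite !mxE /cycle_inc /= !(eq_sym j).
by case: eqP => [<-|_]; rewrite ?(negPf (cycle_perm_neq _ _)) //= ?addr0 ?add0r.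
Qed.

Lemma cycle_stabP (R : nzSemiRingType) (g : mxsym n) : 1 < n ->
  reflect (forall i j, cycle_inc i j =
    if mxsym_tr g then cycle_inc (mxsym_col g j) (mxsym_row g i)
    else cycle_inc (mxsym_row g i) (mxsym_col g j))
  (g \in mxsym_stab (1%:M + perm_mx (cycle_perm n) : 'M[R]_n)%R).
Proof.
move=> n_gt1; rewrite inE; apply: (iffP eqP) => [/matrixP gM i j | incg].
  have natb_inj (b c : bool) : (b%:R = c%:R :> R)%R -> b = c.
    by case: b; case: c => // /eqP; rewrite ?(eq_sym 0%R) oner_eq0.
  apply: natb_inj; have := gM i j; rewrite mxsym_actE !cycle_mxE // => <-.
  by case: ifP.
apply/matrixP=> i j; rewrite mxsym_actE !cycle_mxE // (incg i j).
by case: ifP.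
Qed.

(** Walk along the 2n-cycle from the fixed arc: each new vertex is adjacent to a fixed one whose
    other neighbour is already fixed, so injectivity forces it to be fixed too. Columns and rows
    alternate. *)
Lemma cycle_inc_rigid (a b : 'S_n) (o : 'I_n) : 1 < n ->
    (forall i j, cycle_inc (a i) (b j) = cycle_inc i j) ->
  a o = o -> b o = o -> a = 1 /\ b = 1.
Proof.
move=> n_gt1 ab ao bo.
have fix_ab k : a ((cycle_perm n ^+ k) o) = (cycle_perm n ^+ k) o
             /\ b ((cycle_perm n ^+ k) o) = (cycle_perm n ^+ k) o.
  elim: k => [|k [aj bj]]; first by rewrite expg0 !perm1.
  rewrite expgSr permM; set j := (cycle_perm n ^+ k) o in aj bj *.
  have neq_j := cycle_perm_neq j n_gt1.
  have bj' : b (cycle_perm n j) = cycle_perm n j.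
    have := ab j (cycle_perm n j).
    rewrite cycle_inc_cycle aj => /orP[|/eqP//].
    by rewrite -{2}bj (inj_eq perm_inj) (negPf neq_j).
  split=> //; have := ab (cycle_perm n j) (cycle_perm n j).
  rewrite cycle_inc_id bj' => /orP[/eqP//|].
  rewrite (inj_eq perm_inj) eq_sym => /eqP aj'.
  by rewrite -{2}aj in aj'; move/perm_inj: aj' neq_j => ->; rewrite eqxx.
have orbit_o i : exists k, (cycle_perm n ^+ k) o = i.
  (* The exponent is [i - o] modulo [n], shifted by [n] to avoid truncated subtraction. *)
  exists (i + (n - o)); apply: val_inj; rewrite /= cycle_permX.
  by rewrite addnCA subnKC ?modnDr ?modn_small // ltnW.
by split; apply/permP=> i; have [k <-] := orbit_o i;
   have [ak bk] := fix_ab k; rewrite perm1.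
Qed.

Lemma card_cycle_stab_le (R : nzSemiRingType) : 1 < n ->
  #|mxsym_stab (1%:M + perm_mx (cycle_perm n) : 'M[R]_n)%R| <= 4 * n.
Proof.
move=> n_gt1; pose o := Ordinal (ltnW n_gt1).
(* These data determine the image of the arc from row [o] to column [o]: the kind and index of the
   image of row [o], then which of its two neighbours is the image of column [o]. *)
pose f (g : mxsym n) :=
  (mxsym_tr g, mxsym_row g o, mxsym_col g o == mxsym_row g o).
have -> : (4 * n = #|{: bool * 'I_n * bool}|)%N.
  by rewrite !card_prod card_bool card_ord mulnAC.
apply: (@leq_card_in _ _ f) => g h gM hM [tr_gh row_gh eq_gh].
have col_gh : mxsym_col g o = mxsym_col h o.
  have := eq_gh; rewrite row_gh.
  have := cycle_stabP _ _ n_gt1 gM o o; have := cycle_stabP _ _ n_gt1 hM o o.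
  rewrite tr_gh row_gh cycle_inc_id /cycle_inc /=.
  set c := mxsym_col g o; set c' := mxsym_col h o; set r := mxsym_row h o.
  case: (mxsym_tr h).
    rewrite !(eq_sym r).
    case: (c' =P r) => [->|_]; case: (c =P r) => [->|_] //= /esym/eqP.
    by move=> rc' /esym/eqP; rewrite -rc' => /perm_inj.
  case: (c' =P r) => [->|_]; case: (c =P r) => [->|_] //= /esym/eqP-> /esym.
  by move/eqP.
(* Permutations compose from left to right, so [g * h^-1] is the quotient that fixes [o] on both
   sides; the transpositions cancel. *)
have : g * h^-1 \in mxsym_stab (1%:M + perm_mx (cycle_perm n) : 'M[R]_n)%R.
  by rewrite groupM ?groupV.
move/(cycle_stabP _ _ n_gt1) => inc_gh.
apply/eqP; rewrite eq_mulgV1; apply/eqP.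
have [tr0 row0 col0] : [/\ mxsym_tr (g * h^-1) = false,
    mxsym_row (g * h^-1) o = o & mxsym_col (g * h^-1) o = o].
  case: (g) (h) tr_gh row_gh col_gh => [a b t] [a' b' t'] /= -> ao bo.
  by case: t'; rewrite mxsym_mulE /mxsym_mul /= !permM ao bo !permK.
case: (g * h^-1) inc_gh tr0 row0 col0 => a b [] //= inc_ab _ ao bo.
by have [|-> ->] := cycle_inc_rigid n_gt1 _ ao bo.
Qed.

(** Row [i] goes to column [cycle_perm n i] and column [j] to row [j]: one step along the
    2n-cycle. *)
Definition stab_rot : mxsym n := GElt (cycle_perm n) 1 true.
Definition stab_refl : mxsym n := GElt rev_perm rev_perm true.

Lemma stab_rotP (R : nzSemiRingType) : 1 < n ->
  stab_rot \in mxsym_stab (1%:M + perm_mx (cycle_perm n) : 'M[R]_n)%R.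
Proof.
move=> n_gt1; apply/cycle_stabP => // i j /=.
by rewrite perm1 /cycle_inc /= (inj_eq perm_inj) orbC !(eq_sym j).
Qed.

Lemma stab_reflP (R : nzSemiRingType) : 1 < n ->
  stab_refl \in mxsym_stab (1%:M + perm_mx (cycle_perm n) : 'M[R]_n)%R.
Proof.
move=> n_gt1; apply/cycle_stabP => // i j /=.
rewrite /cycle_inc /= (inj_eq perm_inj) (eq_sym i) -(rev_cycle_perm i).
by rewrite (inj_eq perm_inj) (inj_eq perm_inj) (eq_sym j (cycle_perm n i)).
Qed.

Lemma stab_rotX k :
  (mxsym_tr (stab_rot ^+ k) = odd k) *
  (stab_rot ^+ k.*2 = GElt (cycle_perm n ^+ k) (cycle_perm n ^+ k) false).
Proof.
split; last first.
  elim: k => [|k IHk]; first by rewrite !expg0.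
  by rewrite doubleS !expgSr IHk !mxsym_mulE /mxsym_mul /= !mulg1.
elim: k => [|k IHk]; first by rewrite expg0.
by rewrite expgS mxsym_mulE /mxsym_mul /= IHk.
Qed.

(** Odd powers transpose, so the order is even; half of it kills the n-cycle and is thus a multiple
    of [n]. *)
Lemma dvdn_order_stab_rot : 0 < n -> n.*2 %| #[stab_rot].
Proof.
move=> n_gt0; have rot1 := expg_order stab_rot.
have even_ord : odd #[stab_rot] = false by rewrite -stab_rotX rot1.
rewrite -(odd_double_half #[stab_rot]) even_ord add0n in rot1 *.
rewrite -!muln2 dvdn_pmul2r // -cycle_permX_eq1 //.
by move: rot1; rewrite stab_rotX => -[-> _].
Qed.

Lemma stab_reflK : stab_refl * stab_refl = 1.
Proof.
by rewrite mxsym_mulE /mxsym_mul /=; congr GElt; apply/permP=> i;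
   rewrite permM rev_permK perm1.
Qed.

Lemma stab_refl_rotK : (stab_refl * stab_rot) * (stab_refl * stab_rot) = 1.
Proof.
rewrite !mxsym_mulE /mxsym_mul /= !mulg1; congr GElt; apply/permP=> i.
  by rewrite permM rev_permK perm1.
by rewrite !permM rev_cycle_perm rev_permK perm1.
Qed.

Lemma cycle_perm_neq1 : 1 < n -> cycle_perm n != 1.
Proof.
move=> n_gt1.
by rewrite -[cycle_perm n]expg1 cycle_permX_eq1 ?dvdn1 ?gtn_eqF // ltnW.
Qed.

(** A power of the rotation would commute with it; comparing row permutations then makes the n-cycle
    trivial. *)
Lemma stab_refl_notin_rot : 1 < n -> stab_refl \notin <[stab_rot]>.
Proof.
move=> n_gt1; apply/negP=> /cycleP[k xE].
have := commuteX k (commute_refl stab_rot).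
rewrite /commute -xE !mxsym_mulE /mxsym_mul /= mulg1 => -[rE _].
have /eqP[] := cycle_perm_neq1 n_gt1.
by apply: (mulIg rev_perm); rewrite mul1g.
Qed.

Lemma cycle_stab_isog (R : nzSemiRingType) : 1 < n ->
  let S := mxsym_stab (1%:M + perm_mx (cycle_perm n) : 'M[R]_n)%R in
  #|S| = (4 * n)%N /\ S \isog 'D_(4 * n).
Proof.
move=> n_gt1 S; pose y := stab_refl * stab_rot.
pose H := <<[set stab_refl; y]>>%G.
have xH : stab_refl \in H by rewrite mem_gen // !inE eqxx.
have zH : stab_rot \in H.
  by rewrite -(groupMl _ xH) mem_gen // !inE eqxx orbT.
have ltzH : <[stab_rot]> \proper H.
  rewrite properE cycle_subG zH /=.
  by apply: contra (stab_refl_notin_rot n_gt1) => /subsetP->.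
(* The rotation group has order at least [2n] and index at least 2 in [H]; with the upper bound on
   the stabilizer, which contains [H], this forces equality. *)
have leH : 4 * n <= #|H|.
  have /dvdnP[q Hq] := cardSg (proper_sub ltzH).
  have /dvdn_leq-/(_ (order_gt0 _)) le_z := dvdn_order_stab_rot (ltnW n_gt1).
  have q_gt1: 1 < q.
    have := proper_card ltzH.
    by rewrite Hq -{1}[#|_|]mul1n ltn_mul2r => /andP[].
  rewrite Hq; apply: leq_trans (leq_mul q_gt1 le_z).
  by rewrite mul2n -!muln2 mulnC -mulnA.
have SH : S = H.
  apply/esym/eqP; rewrite eqEcard (leq_trans (card_cycle_stab_le R n_gt1) leH).
  rewrite andbT gen_subG subUset !sub1set stab_reflP //=.
  by rewrite groupM ?stab_reflP ?stab_rotP.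
have cardS : #|S| = (4 * n)%N.
  by apply/eqP; rewrite eqn_leq card_cycle_stab_le // SH.
split=> //; rewrite -cardS SH; apply: involutions_gen_dihedral.
- apply: nt_prime_order => //; last by apply/eqP=> -[].
  by rewrite expgS expg1 stab_reflK.
- apply: nt_prime_order => //; first by rewrite expgS expg1 stab_refl_rotK.
  apply: contra (cycle_perm_neq1 n_gt1) => /eqP[r1].
  by rewrite mulg1 in r1; rewrite r1 mul1g => ->.
(* The two involutions differ because only [stab_refl] transposes. *)
by apply/eqP=> -[].
Qed.

End CyclePerm.

Theorem theorem4p5 (R : nzSemiRingType) (n : nat) (hn : (2 < n)%N) :
  let M : 'M[R]_n := (1%:M + perm_mx (cycle_perm n))%R in
  (mxsym_stab M \isog 'D_(4 * n)%N)%g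
  /\ #|` mxsym_orbit M|%fset = ((n.-1)`! * n`! %/ 2)%N.
Proof.
move=> M; have [cardS isoS] := cycle_stab_isog R (ltnW hn).
split=> //; rewrite card_mxsym_orbit -divgS ?subsetT //= cardS cardsT card_mxsym.
case: n hn {M cardS isoS} => // m _; rewrite factS /=.
(* With [n = m.+1], the factor [2n] is isolated in both [2 (n!)^2] and [4n] so that it cancels,
   leaving the divisor 2. *)
rewrite (_ : 2 * _ = m`! * (m.+1 * m`!) * (2 * m.+1))%N; last first.
  by rewrite -mulnn [RHS]mulnCA [in RHS]mulnAC [in RHS](mulnC m`!).
rewrite (_ : 4 * m.+1 = 2 * (2 * m.+1))%N; last by rewrite mulnA.
by rewrite divnMr.
Qed.
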